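(* Let $G$ be a graph of order $n\ge 3$ and let $e\in E(G)$. Then the following statements hold. (i) If $\rho_e^o(G)=2$, then $1\le \rho_e^o(G-e)\le 3$. (ii) If $\rho_e^o(G)\ge 3$, then $\rho_e^o(G)-1\le \rho_e^o(G-e)\le 2(\rho_e^o(G)-1)$.
   Context: All graphs are finite and simple. A set $B\subseteq E(G)$ is an edge open packing set (EOP set) of $G$ if for every two distinct edges $e_1,e_2\in B$ there is no edge $f\in E(G)\setminus\{e_1,e_2\}$ joining an endvertex of $e_1$ to an endvertex of $e_2$ (i.e. there is no edge $f$ such that $e_1,f,e_2$ form a path with $f$ in the middle or a triangle). Two edges of $B$ are allowed to share an endvertex. The edge open packing number $\rho_e^o(G)$ is the maximum cardinality of an EOP set of $G$ (the subscript $e$ in $\rho_e^o$ is part of the notation and does not refer to the edge $e$). $G-e$ denotes the graph with vertex set $V(G)$ and edge set $E(G)\setminus\{e\}$. *)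

(* Defs.v *)
From mathcomp Require Import all_boot.

Set Implicit Arguments.
Unset Strict Implicit.
Unset Printing Implicit Defensive.

(* A finite simple graph whose vertex set is the whole of T. *)
Record sgraph (T : finType) := SGraph {
  edges : {set {set T}};
  edges_card2 : forall f : {set T}, f \in edges -> #|f| = 2 }.

Lemma del_edge_card2 (T : finType) (G : sgraph T) (e f : {set T}) :
  f \in edges G :\ e -> #|f| = 2.
Proof. by case/setD1P=> _; apply: edges_card2. Qed.

Definition del_edge (T : finType) (G : sgraph T) (e : {set T}) : sgraph T :=
  SGraph (@del_edge_card2 T G e).

Definition joins (T : finType) (f e1 e2 : {set T}) : bool :=
  [exists x in e1, exists y in e2, f == [set x; y]].

(* If e1 and e2 share an endvertex, the only edge other than e1 and e2 that
   can join them is the one closing a triangle. *)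
Definition edge_open_packing (T : finType) (G : sgraph T)
    (B : {set {set T}}) : bool :=
  (B \subset edges G) &&
  [forall e1 in B, forall e2 in B, (e1 != e2) ==>
     ~~ [exists f in edges G :\: [set e1; e2], joins f e1 e2]].

(* The maximum ranges over a nonempty family, since set0 is an edge open
   packing set. *)
Definition eop_number (T : finType) (G : sgraph T) : nat :=
  \max_(B : {set {set T}} | edge_open_packing G B) #|B|.

(* Main.v *)
Require Import Defs.
From mathcomp Require Import all_boot zify.

Set Implicit Arguments.
Unset Strict Implicit.
Unset Printing Implicit Defensive.

(** The vertex set of an edge open packing set [B] spans no edges besides those
    of [B]: an edge whose ends lie in two different members of [B] is itself one
    of these two ([edge_open_packingP]).  Everything is deduced from this.

    Deleting an edge removes possible obstructions, so if [B] is a packing set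
    of [G] then [B :\ e] is one of [G - e]; this gives the lower bounds.

    For the upper bounds let [B] be a packing set of [G - e], with [e = uv], and
    let [B_u], [B_v] be the members of [B] at [u] and at [v].  They are disjoint
    since [e] is not in [B].  Without [B_u], or without [B_v], the set [B] is a
    packing set of [G], because [e] can no longer join two of its members
    ([packing_del_star]).
    - If [B_u] or [B_v] has at most one member, then removing it shows
      [#|B| <= rho(G) + 1].
    - Otherwise [u] and [v] are both centres of stars with at least two edges.
      In [G - e] the only edges from such a centre to the vertices covered by
      [B] are the edges of its own star ([star_center_edge]), so after
      removing [B_v] the edge [e] can be added as a further ray at [u]
      ([packing_add_deleted]): [#|B| - #|B_v| + 1 <= rho(G)], and likewise with
      [B_u].  Adding the two inequalities and using [#|B_u| + #|B_v| <= #|B|]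
      gives [#|B| <= 2 * (rho(G) - 1)].

    The alternative [rho(G) + 1] is 3 for [rho(G) = 2], and is at most
    [2 * (rho(G) - 1)] as soon as [rho(G) >= 3]. *)

Lemma edge_open_packingP (T : finType) (G : sgraph T) (B : {set {set T}}) :
  reflect (B \subset edges G /\
           forall g h x y, g \in B -> h \in B -> g != h -> x \in g -> y \in h ->
             [set x; y] \in edges G -> [set x; y] \in [set g; h])
          (edge_open_packing G B).
Proof.
apply: (iffP andP) => -[subB packB]; split=> //.
  move=> g h x y gB hB neq_gh xg yh xyG; apply/negPn/negP=> xy_new.
  move/forall_inP/(_ g gB)/forall_inP/(_ h hB)/implyP/(_ neq_gh)/negP: packB.
  apply; apply/exists_inP; exists [set x; y]; first by rewrite inE xy_new.
  by apply/exists_inP; exists x => //; apply/exists_inP; exists y.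
apply/forall_inP=> g gB; apply/forall_inP=> h hB; apply/implyP=> neq_gh.
apply/negP=> /exists_inP[f /setDP[fG f_new]].
case/exists_inP=> x xg /exists_inP[y yh /eqP def_f].
by rewrite def_f (packB g h x y) // -def_f in f_new.
Qed.

Lemma leq_eop_number (T : finType) (G : sgraph T) (B : {set {set T}}) :
  edge_open_packing G B -> #|B| <= eop_number G.
Proof. exact: (@leq_bigmax_cond _ _ (fun B : {set {set T}} => #|B|)). Qed.

Lemma packing_del_edge (T : finType) (G : sgraph T) (e : {set T})
    (B : {set {set T}}) :
  edge_open_packing G B -> edge_open_packing (del_edge G e) (B :\ e).
Proof.
case/edge_open_packingP=> subB packB; apply/edge_open_packingP.
split=> [|g h x y /setD1P[_ gB] /setD1P[_ hB] neq_gh xg yh /setD1P[_ xyG]].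
  exact: setSD.
exact: packB.
Qed.

Lemma edge_neq (T : finType) (G : sgraph T) (x y : T) :
  [set x; y] \in edges G -> x != y.
Proof. by move/edges_card2; rewrite cards2; case: eqP. Qed.

Lemma edge_eq_set2 (T : finType) (G : sgraph T) (g : {set T}) (x y : T) :
  g \in edges G -> x \in g -> y \in g -> x != y -> g = [set x; y].
Proof.
move=> gG xg yg neq_xy; apply/esym/eqP.
by rewrite eqEcard subUset !sub1set xg yg (edges_card2 gG) cards2 neq_xy.
Qed.

Definition star (T : finType) (B : {set {set T}}) (u : T) : {set {set T}} :=
  [set g in B | u \in g].

Lemma star_sub (T : finType) (B : {set {set T}}) (u : T) : star B u \subset B.
Proof. by apply/subsetP=> g; rewrite inE => /andP[]. Qed.

(** If [x] lies on a member [g] avoiding [u], the edge [ux] joins [g] to every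
    ray at [u].  With two rays at [u], one of them is not [ux], and the packing
    condition for this ray and [g] leaves only [g = ux]. *)
Lemma star_center_edge (T : finType) (G : sgraph T) (B : {set {set T}})
    (g : {set T}) (u x : T) :
  edge_open_packing G B -> 1 < #|star B u| -> g \in B -> x \in g ->
  [set u; x] \in edges G -> g = [set u; x].
Proof.
case/edge_open_packingP=> subB packB rays gB xg uxG.
have gG := subsetP subB g gB.
have [ug | u'g] := boolP (u \in g).
  exact: edge_eq_set2 gG ug xg (edge_neq uxG).
have [h] : exists h, h \in star B u :\ [set u; x].
  apply/card_gt0P; move: rays; rewrite (cardsD1 [set u; x]).
  by case: (_ \in star B u) => //; apply: ltnW.
rewrite !inE => /and3P[neq_h_ux hB uh].
have neq_hg : h != g by apply: contraNneq u'g => <-.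
have := packB h g u x hB gB neq_hg uh xg uxG.
by rewrite !inE eq_sym (negPf neq_h_ux) => /eqP->.
Qed.

(** Once no remaining member contains [u], the restored edge [e] can join none
    of them, so the packing condition of [G - e] suffices. *)
Lemma packing_del_star (T : finType) (G : sgraph T) (e : {set T})
    (B : {set {set T}}) (u : T) :
  u \in e -> edge_open_packing (del_edge G e) B ->
  edge_open_packing G (B :\: star B u).
Proof.
move=> ue /edge_open_packingP[subB packB]; apply/edge_open_packingP; split.
  exact: subset_trans (subsetDl _ _) (subset_trans subB (subsetDl _ _)).
move=> g h x y; rewrite !inE => /andP[+ gB] /andP[+ hB] neq_gh xg yh xyG.
rewrite gB hB => u'g u'h; rewrite -in_set2.
apply: packB => //; rewrite !inE xyG andbT.
apply/eqP=> def_e; move: ue; rewrite -def_e !inE.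
by case/orP=> /eqP eq_u; move: u'g u'h; rewrite eq_u ?xg ?yh.
Qed.

(** With the star at [v] removed, [uv] joins no two remaining members.  Any other
    edge between [uv] and a remaining member starts at [u] or at [v]; as both
    are centres, it is that member itself. *)
Lemma packing_add_deleted (T : finType) (G : sgraph T) (B : {set {set T}})
    (u v : T) :
  let e := [set u; v] in
  e \in edges G -> edge_open_packing (del_edge G e) B ->
  1 < #|star B u| -> 1 < #|star B v| ->
  edge_open_packing G (e |: (B :\: star B v)).
Proof.
move=> e eG packB rays_u rays_v.
have ve : v \in e by rewrite !inE eqxx orbT.
have /edge_open_packingP[subD packD] := packing_del_star ve packB.
(* By symmetry of joining, it is enough to treat an edge leaving e. *)
have packe g x y : g \in B :\: star B v -> x \in e -> y \in g ->
    [set x; y] \in edges G -> [set x; y] \in [set e; g].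
  case/setDP=> gB _ xe yg xyG; rewrite in_set2.
  case: eqVneq => //= neq_xy_e.
  have xyH : [set x; y] \in edges (del_edge G e) by apply/setD1P.
  have rays_x : 1 < #|star B x| by case/set2P: xe => ->.
  by rewrite (star_center_edge packB rays_x gB yg xyH).
apply/edge_open_packingP; split; first by rewrite subUset sub1set eG.
move=> g h x y /setU1P[-> | gD] /setU1P[-> | hD] neq_gh xg yh xyG.
- by rewrite eqxx in neq_gh.
- exact: packe.
- by rewrite setUC [[set g; e]]setUC; apply: packe; rewrite // setUC.
- exact: packD.
Qed.

Lemma disjoint_stars (T : finType) (G : sgraph T) (B : {set {set T}})
    (u v : T) :
  let e := [set u; v] in
  e \in edges G -> B \subset edges (del_edge G e) ->
  [disjoint star B u & star B v].
Proof.
move=> e eG subB; rewrite disjoint_subset; apply/subsetP=> g.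
rewrite !inE => /andP[gB ug]; rewrite gB /=; apply/negP=> vg.
have /setD1P[/eqP neq_ge gG] := subsetP subB g gB.
exact/neq_ge/(edge_eq_set2 gG ug vg)/(edge_neq eG).
Qed.

Lemma card_packing_del_edge (T : finType) (G : sgraph T) (e : {set T})
    (B : {set {set T}}) :
  e \in edges G -> edge_open_packing (del_edge G e) B ->
  #|B| <= eop_number G + 1 \/ #|B| <= 2 * (eop_number G - 1).
Proof.
move=> eG packB; have /eqP/cards2P[u [v [_ def_e]]] := edges_card2 eG.
rewrite {}def_e in eG packB.
have card_del w : #|B :\: star B w| + #|star B w| = #|B|.
  by rewrite addnC -(cardsID (star B w) B) (setIidPr (star_sub B w)).
have few w : w \in [set u; v] -> #|star B w| <= 1 -> #|B| <= eop_number G + 1.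
  move=> we le1; have := leq_eop_number (packing_del_star we packB).
  by have := card_del w; lia.
have [le1 | gt1u] := leqP #|star B u| 1; first by left; exact: few (set21 u v) le1.
have [le1 | gt1v] := leqP #|star B v| 1; first by left; exact: few (set22 u v) le1.
right.
have card_add w z : [set w; z] = [set u; v] -> 1 < #|star B w| ->
    1 < #|star B z| -> #|B| - #|star B z| + 1 <= eop_number G.
  move=> eq_wz rays_w rays_z; rewrite -eq_wz in eG packB.
  have := leq_eop_number (packing_add_deleted eG packB rays_w rays_z).
  rewrite cardsU1.
  have /edge_open_packingP[/subsetP subB _] := packB.
  have /negPf-> : [set w; z] \notin B :\: star B z.
    by apply/negP=> /setDP[/subB]; rewrite setD11.
  by have := card_del z; rewrite /=; lia.
have := card_add u v erefl gt1u gt1v.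
have := card_add v u (setUC _ _) gt1v gt1u.
have /edge_open_packingP[subB _] := packB.
have disj := disjoint_stars eG subB.
have : #|star B u :|: star B v| <= #|B|.
  by apply/subset_leq_card; rewrite subUset !star_sub.
rewrite cardsU (disjoint_setI0 disj) cards0.
lia.
Qed.

Theorem theorem4p2 (T : finType) (G : sgraph T) (e : {set T})
    (hn : 3 <= #|T|) (he : e \in edges G) :
  (eop_number G = 2 -> 1 <= eop_number (del_edge G e) <= 3) /\
  (3 <= eop_number G ->
     eop_number G - 1 <= eop_number (del_edge G e) <= 2 * (eop_number G - 1)).
Proof.
have lower : eop_number G <= eop_number (del_edge G e) + 1.
  apply/bigmax_leqP=> B packB.
  have := leq_eop_number (packing_del_edge e packB).
  rewrite [in X in _ -> X](cardsD1 e B) addnC => le_rho.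
  exact: leq_add le_rho (leq_b1 _).
have upper k : eop_number G + 1 <= k -> 2 * (eop_number G - 1) <= k ->
    eop_number (del_edge G e) <= k.
  move=> le1 le2; apply/bigmax_leqP=> B packB.
  by case: (card_packing_del_edge he packB); lia.
by split=> rho; apply/andP; (split; last apply: upper); lia.
Qed.
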